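(* Let $N_1(B)$ denote the number of triples $(x,y,z)$ of positive integers with $\gcd(x,y,z)=1$, $x+y=z$, $x,y,z\leq B$ and $x,y,z$ all squareful. Then $$ N_1(B)=O\left(B^{3/5}(\log B)^{12}\right), $$ i.e. there is an absolute constant $K>0$ such that $N_1(B)\leq K B^{3/5}(\log B)^{12}$ for all $B\geq 2$.
   Context: An integer $k$ is squareful (i.e. $2$-powerful) if $p^2\mid k$ whenever $p$ is a prime divisor of $k$ (so $1$ is squareful). *)

(* Defs.v *)
From HB Require Import structures.
From mathcomp Require Import all_boot all_order all_algebra.
From mathcomp Require Import finmap.
From mathcomp Require Import all_classical all_reals all_analysis.

Set Implicit Arguments.
Unset Strict Implicit.
Unset Printing Implicit Defensive.

Import Order.TTheory GRing.Theory Num.Theory.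

Local Open Scope classical_set_scope.
Local Open Scope ring_scope.

Definition squareful (k : nat) : Prop :=
  forall p : nat, prime p -> (p %| k)%N -> (p ^ 2 %| k)%N.

Definition squareful_triples (R : realType) (B : R) : set (nat * nat * nat) :=
  [set t | let: (x, y, z) := t in
    [/\ [/\ (0 < x)%N, (0 < y)%N & (0 < z)%N],
        gcdn (gcdn x y) z = 1%N,
        (x + y)%N = z,
        [/\ x%:R <= B, y%:R <= B & z%:R <= B] &
        [/\ squareful x, squareful y & squareful z]]].

(* [fset_set] sends infinite sets to [fset0]; this lemma shows that [N1] below
   is a genuine count. *)
Lemma finite_squareful_triples (R : realType) (B : R) :
  finite_set (squareful_triples B).
Proof.
set n := (Num.truncn B).+1.
apply: (@sub_finite_set _ _ ((`I_n `*` `I_n) `*` `I_n)); last first.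
  by do 2![apply: finite_setX; last exact: finite_II]; exact: finite_II.
move=> [[x y] z] /= [_ _ _ [xB yB zB] _].
have H m : m%:R <= B -> (m < n)%N.
  by move=> mB; rewrite -(ltr_nat R); exact: le_lt_trans mB (truncnS_gt B).
by split; [split|]; exact: H.
Qed.

Definition N1 (R : realType) (B : R) : nat :=
  #|` fset_set (squareful_triples B)|%fset.

(* Main.v *)
(* Write x = x0^2 x1^3, and similarly y and z, and let T = B^(3/5).  Since
   (x0 y0 z0)^2 (x1 y1 z1)^3 <= B^3, either P = x1 y1 z1 <= T or
   Q = x0 y0 z0 <= T.  In the first case fix (x1, y1, z1) and count points
   on the conic x1^3 X^2 + y1^3 Y^2 = z1^3 Z^2; in the second fix
   (x0, y0, z0) and count points on the cubic x0^2 X^3 + y0^2 Y^3 = z0^2 Z^3.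
   Both are curves a X^n + b Y^n = c Z^n with a, b, c pairwise coprime.

   Modulo c the ratio X / Y is an n-th root of -b / a, and similarly modulo a
   and b, so the solutions fall into few classes such that n times the
   determinant of any three solutions of a class is a multiple of abc.  Cutting
   the real curve u^n + v^n = 1 into arcs of length about 1 / K, with K about
   T / P (resp. T / Q), makes this determinant smaller than abc / n, hence zero.
   As the curve is strictly convex no three of its points are collinear, so
   each class contains at most two solutions on each arc.

   The number of classes is at most a constant times t(p) t(q) t(r), where p, q,
   r are the bases of the coefficients a, b, c (powers of exponent 3 or 2) and
   t(g) counts the chains of divisors e1 | e2 | g.  As P = pqr (resp. Q = pqr),
   the whole count is O(T S^3) with S the sum of t(g) / g over g <= B, and
   S <= (1 + log B)^3. *)

Require Import Defs.
From HB Require Import structures.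
From mathcomp Require Import all_boot all_order all_algebra.
From mathcomp Require Import finmap.
From mathcomp Require Import all_classical all_reals all_analysis.
From mathcomp Require Import ring lra zify.

Set Implicit Arguments.
Unset Strict Implicit.
Unset Printing Implicit Defensive.

Import Order.TTheory GRing.Theory Num.Theory.

Local Open Scope ring_scope.

(** * Ratios of solutions modulo a coefficient *)

Lemma Euclid_dvdzM (p : nat) (x y : int) :
  prime p -> (p %| x * y)%Z = (p %| x)%Z || (p %| y)%Z.
Proof. by move=> p_pr; rewrite !dvdzE abszM Euclid_dvdM. Qed.

Lemma Gauss_dvdz_pexp (p k : nat) (x y : int) :
  prime p -> ~~ (p %| x)%Z -> ((p ^ k)%N %| y * x)%Z -> ((p ^ k)%N %| y)%Z.
Proof.
move=> p_pr px; rewrite Gauss_dvdzl // coprimezE.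
by rewrite coprimeXl // prime_coprime.
Qed.

(** The cofactor of x - y in x ^ n - y ^ n is congruent to n x ^ (n - 1) modulo p, so it is prime to
    p unless p = n. In that case it is n times a number prime to p, whence the factor n in the
    conclusion; for n = p = 2 this needs 4 to divide x - y. *)
Lemma pexp_dvdz_subX (n p k : nat) (x y : int) :
    prime p -> (n == 2%N) || (n == 3%N) -> ~~ (p %| x)%Z -> (p %| x - y)%Z ->
    (n = 2%N -> p = 2%N -> (4 %| x - y)%Z) ->
  ((p ^ k)%N %| x ^+ n - y ^+ n)%Z -> ((p ^ k)%N %| n%:Z * (x - y))%Z.
Proof.
move=> p_pr /orP[]/eqP -> px pxy.
- have -> : x ^+ 2 - y ^+ 2 = (x - y) * (x + y) by ring.
  have [p2 /(_ erefl p2) xy4|p2 _] := eqVneq p 2%N.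
    have [w {}xy4] : exists w : int, x - y = w * 4 by exact/dvdzP.
    rewrite p2 in p_pr px *.
    have -> : y = x - w * 4 by rewrite -xy4; ring.
    have -> : (x - (x - w * 4)) * (x + (x - w * 4)) = 2 * (x - (x - w * 4)) * (x - 2 * w).
      by ring.
    apply: Gauss_dvdz_pexp => //; apply: contra px => e.
    have -> : x = (x - 2 * w) + 2 * w by ring.
    by rewrite rpredD // dvdz_mulr.
  move=> /(Gauss_dvdz_pexp p_pr) H; apply: dvdz_mull; apply: H.
  apply: contra px => pxy'.
  have : (p %| 2 * x)%Z.
    have -> : 2 * x = (x - y) + (x + y) by ring.
    exact: rpredD.
  by rewrite Euclid_dvdzM // dvdzE /= dvdn_prime2 // (negPf p2).
- move=> _.
  have -> : x ^+ 3 - y ^+ 3 = (x - y) * (x * y * 3 + (x - y) * (x - y)) by ring.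
  have py : ~~ (p %| y)%Z.
    by apply: contra px => py; rewrite -(subrK y x) rpredD.
  have [p3|p3] := eqVneq p 3%N.
    have [w xy3] : exists w : int, x - y = w * 3 by apply/dvdzP; rewrite p3 in pxy.
    rewrite xy3.
    have -> : w * 3 * (x * y * 3 + w * 3 * (w * 3)) =
      3 * (w * 3) * (x * y + w * w * 3) by ring.
    apply: Gauss_dvdz_pexp => //; rewrite -p3.
    rewrite rpredDr; last by rewrite p3 dvdz_mull.
    by rewrite Euclid_dvdzM // negb_or px.
  move=> /(Gauss_dvdz_pexp p_pr) H; apply: dvdz_mull; apply: H.
  rewrite rpredDr; last by rewrite dvdz_mull.
  by rewrite !Euclid_dvdzM // !negb_or px py dvdzE /= dvdn_prime2.
Qed.

(** A vanishing cross product means equal ratios modulo d; since y0 is invertible, equality passes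
    through the ratio x0 / y0. *)
Lemma dvdz_cross_trans (d : nat) (x y x' y' x0 y0 : int) :
    coprime d `|y0| -> (d %| x * y0 - x0 * y)%Z -> (d %| x' * y0 - x0 * y')%Z ->
  (d %| x * y' - x' * y)%Z.
Proof.
move=> dy0 dr dr'; rewrite -(@Gauss_dvdzr _ y0) //.
have -> : y0 * (x * y' - x' * y) =
    (x * y0 - x0 * y) * y' - (x' * y0 - x0 * y') * y by ring.
by rewrite rpredB // dvdz_mulr.
Qed.

(* The polynomial [T^n - c] has at most [n <= 3] roots mod [p]: two roots that
   both differ from [n - 1] given ones coincide. *)
Lemma dvdz_cross_last_root (n p : nat) (x0 y0 x1 y1 x y x' y' : int) :
    prime p -> (n == 2%N) || (n == 3%N) ->
    ~~ (p %| y0)%Z -> ~~ (p %| y1)%Z ->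
    (p %| (x1 * y0) ^+ n - (x0 * y1) ^+ n)%Z ->
    (p %| (x * y0) ^+ n - (x0 * y) ^+ n)%Z ->
    (p %| (x' * y0) ^+ n - (x0 * y') ^+ n)%Z ->
    ~~ (p %| x1 * y0 - x0 * y1)%Z ->
    ~~ (p %| x * y0 - x0 * y)%Z -> ~~ (p %| x' * y0 - x0 * y')%Z ->
    ~~ (p %| x * y1 - x1 * y)%Z -> ~~ (p %| x' * y1 - x1 * y')%Z ->
  (p %| x * y' - x' * y)%Z.
Proof.
move=> p_pr /orP[]/eqP -> py0 py1.
- have sq u v : u ^+ 2 - v ^+ 2 = (u - v) * (u + v) :> int by ring.
  rewrite !sq !Euclid_dvdzM // => _ H H' _ /negPf nr /negPf nr' _ _.
  rewrite nr nr' /= in H H'.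
  have : (p %| y0 * (x * y' - x' * y))%Z.
    have -> : y0 * (x * y' - x' * y) =
      (x * y0 + x0 * y) * y' - (x' * y0 + x0 * y') * y by ring.
    by rewrite rpredB // dvdz_mulr.
  by rewrite Euclid_dvdzM // (negPf py0).
- have cb u v : u ^+ 3 - v ^+ 3 = (u - v) * (u ^+ 2 + u * v + v ^+ 2) :> int
    by ring.
  rewrite !cb !Euclid_dvdzM // => H1 H H' /negPf n10 /negPf n0 /negPf n0' n1 n1'.
  rewrite n10 n0 n0' /= in H1 H H'.
  (* With t0, t1, t the ratios x0 / y0, x1 / y1, u / v, both t and t1 are roots of T^2 + t0 T +
     t0^2. Subtracting gives (t - t1) (t + t0 + t1) = 0, so t = - (t0 + t1). *)
  have third u v : (p %| (u * y0) ^+ 2 + u * y0 * (x0 * v) + (x0 * v) ^+ 2)%Z ->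
      ~~ (p %| u * y1 - x1 * v)%Z ->
      (p %| u * y1 * y0 + v * (x1 * y0 + x0 * y1))%Z.
    move=> K nuv.
    have : (p %| y0 * (u * y1 - x1 * v) *
              (u * y1 * y0 + v * (x1 * y0 + x0 * y1)))%Z.
      have -> : y0 * (u * y1 - x1 * v) *
          (u * y1 * y0 + v * (x1 * y0 + x0 * y1)) =
        ((u * y0) ^+ 2 + u * y0 * (x0 * v) + (x0 * v) ^+ 2) * y1 ^+ 2 -
        ((x1 * y0) ^+ 2 + x1 * y0 * (x0 * y1) + (x0 * y1) ^+ 2) * v ^+ 2 by ring.
      by rewrite rpredB // dvdz_mulr.
    by rewrite !Euclid_dvdzM // (negPf py0) (negPf nuv).
  have : (p %| y0 * y1 * (x * y' - x' * y))%Z.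
    have -> : y0 * y1 * (x * y' - x' * y) =
      (x * y1 * y0 + y * (x1 * y0 + x0 * y1)) * y' -
      (x' * y1 * y0 + y' * (x1 * y0 + x0 * y1)) * y by ring.
    by rewrite rpredB // dvdz_mulr // third.
  by rewrite !Euclid_dvdzM // (negPf py0) (negPf py1).
Qed.

Definition divisor_chains (z : nat) : seq (nat * nat) :=
  [seq (e, d) | e <- divisors z, d <- divisors e].

(* The label of [r] is [(e2, e1)] where [e1 = gcd (z, [r, r0])] and
   [e2 = gcd (z, [r, r1])], with [r1] a representative of the value [e1]; it
   records modulo which primes the ratio [x r / y r] agrees with two fixed
   roots, and the third root is then determined. *)
Lemma exists_ratio_label (T : eqType) (s : seq T) (x y : T -> int) (n m z : nat) :
    (n == 2%N) || (n == 3%N) -> (0 < m)%N -> (z %| m)%N ->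
    (forall p, prime p -> (p %| m)%N -> (p %| z)%N) ->
    {in s, forall r, coprime m `|x r| && coprime m `|y r|} ->
    {in s &, forall r r', (m %| (x r * y r') ^+ n - (x r' * y r) ^+ n)%Z} ->
  exists2 f : T -> nat * nat, {in s, forall r, f r \in divisor_chains z} &
    {in s &, forall r r', f r = f r' ->
      (n = 2%N -> (4 %| x r * y r' - x r' * y r)%Z) ->
      (m %| n%:Z * (x r * y r' - x r' * y r))%Z}.
Proof.
move=> n23 m0 zm mz cop eqn; case: s cop eqn => [|r0 s0].
  by exists (fun=> (0, 0)%N).
set s := r0 :: s0 => cop eqn.
pose e1 r := gcdn z `|(x r * y r0 - x r0 * y r)%R|.
pose r1 e := head r0 [seq r <- s | e1 r == e].
pose e2 r := gcdn z `|(x r * y (r1 (e1 r)) - x (r1 (e1 r)) * y r)%R|.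
have z0 : (0 < z)%N by rewrite (dvdn_gt0 m0).
have r0s : r0 \in s by rewrite mem_head.
have r1P r : r \in s -> r1 (e1 r) \in s /\ e1 (r1 (e1 r)) = e1 r.
  move=> rs; rewrite /r1; set t := [seq _ <- s | _].
  have : r \in t by rewrite mem_filter eqxx.
  case E : t => [//|r' t'] _ /=.
  have : r' \in t by rewrite E mem_head.
  by rewrite mem_filter => /andP[/eqP].
have cy r d : r \in s -> (d %| z)%N -> coprime d `|y r|.
  by move=> /cop/andP[_] + dz; apply: coprime_dvdl; apply: dvdn_trans zm.
exists (fun r => (e2 r, e1 r)).
  move=> r rs; apply/allpairsPdep; exists (e2 r), (e1 r).
  rewrite -!dvdn_divisors ?gcdn_gt0 ?z0 // dvdn_gcdl; split=> //.
  (* [e1 r] divides [e2 r]: modulo [e1 r], both [r] and its representative have the ratio of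
     [r0]. *)
  rewrite dvdn_gcd dvdn_gcdl /=.
  have [r1s r1e] := r1P r rs.
  apply: (@dvdz_cross_trans _ _ _ _ _ (x r0) (y r0)).
  - by apply: cy => //; apply: dvdn_gcdl.
  - exact: dvdn_gcdr.
  - have := dvdn_gcdr z `|(x (r1 (e1 r)) * y r0 - x r0 * y (r1 (e1 r)))%R|.
    by rewrite -/(e1 (r1 (e1 r))) r1e.
move=> r r' rs r's [e2e e1e] H4.
rewrite dvdzE; apply/dvdn_partP => // p; rewrite mem_primes => /and3P[p_pr _ pm].
rewrite p_part.
have pz := mz p p_pr pm.
have pxy u : u \in s -> ~~ (p %| x u)%Z && ~~ (p %| y u)%Z.
  move=> /cop/andP[cx cy']; rewrite !dvdzE -!prime_coprime //.
  by rewrite !(coprime_dvdl pm).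
have px u : u \in s -> ~~ (p %| x u)%Z by move=> /pxy/andP[].
have py u : u \in s -> ~~ (p %| y u)%Z by move=> /pxy/andP[].
have cpy u : u \in s -> coprime p `|y u| by move=> us; apply: cy.
have peqn u v : u \in s -> v \in s ->
    (p %| (x u * y v) ^+ n - (x v * y u) ^+ n)%Z.
  by move=> us vs; apply: dvdz_trans (eqn u v us vs).
have pe u v : (p %| gcdn z `|(x u * y v - x v * y u)%R|)%N =
    (p %| x u * y v - x v * y u)%Z by rewrite dvdn_gcd pz.
apply: (@pexp_dvdz_subX n) => //.
- by rewrite Euclid_dvdzM // negb_or px ?py.
- have [r1s r1e] := r1P r rs.
  (* Modulo p the ratios of [r] and [r'] both agree with that of [r0], or both with that of the
     common representative, or neither agrees with these; in the last case [dvdz_cross_last_root]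
     applies. *)
  have [pe1|pe1] := boolP (p %| e1 r)%N.
    apply: (@dvdz_cross_trans _ _ _ _ _ (x r0) (y r0)); first exact: cpy.
      by rewrite -pe.
    by rewrite -pe -/(e1 r') -e1e.
  have [pe2|pe2] := boolP (p %| e2 r)%N.
    apply: (@dvdz_cross_trans _ _ _ _ _ (x (r1 (e1 r))) (y (r1 (e1 r)))).
    - exact: cpy.
    - by rewrite -pe.
    - by rewrite -pe e1e -/(e2 r') -e2e.
  apply: (@dvdz_cross_last_root n p (x r0) (y r0) (x (r1 (e1 r))) (y (r1 (e1 r)))) => //.
  + exact: py.
  + exact: py.
  + exact: peqn.
  + exact: peqn.
  + exact: peqn.
  + by rewrite -pe -/(e1 _) r1e.
  + by rewrite -pe.
  + by rewrite -pe -/(e1 _) -e1e.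
  + by rewrite -pe.
  + by rewrite -pe e1e -/(e2 _) -e2e.
- by move=> n2 _; apply: H4.
- apply: dvdz_trans (eqn r r' rs r's).
  by rewrite dvdzE /= pfactor_dvdn.
Qed.

(** * Determinants of points on the curve u^n + v^n = 1 *)

(** For n in {2, 3} this is (x ^ n - y ^ n) / (x - y), written as a polynomial so that it also makes
    sense for x = y. *)
Definition pow_quot (R : nzRingType) (n : nat) (x y : R) : R :=
  if n == 2%N then x + y else x ^+ 2 + x * y + y ^+ 2.

Section FermatCurve.
Variables (R : realFieldType) (n : nat).
Hypothesis n23 : (n == 2%N) || (n == 3%N).
Implicit Types x y u v d : R.
Local Notation h := (@pow_quot R n).

Lemma subX_pow_quot x y : x ^+ n - y ^+ n = (x - y) * h x y.
Proof. by rewrite /pow_quot; case/orP: n23 => /eqP -> /=; ring. Qed.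

Lemma pow_quot_ge0 x y : 0 <= x -> 0 <= y -> 0 <= h x y.
Proof. by move=> *; rewrite /pow_quot; case: ifP => _; nra. Qed.

Lemma pow_quot_gt0 x y : 0 < x -> 0 < y -> 0 < h x y.
Proof. by move=> *; rewrite /pow_quot; case: ifP => _; nra. Qed.

Lemma pow_quot_le x y : 0 <= x <= 1 -> 0 <= y <= 1 -> h x y <= 3.
Proof.
move=> /andP[??] /andP[??]; rewrite /pow_quot; case: ifP => _; first lra.
nra.
Qed.

Lemma pow_quot_ge x y : 2^-1 <= x -> 2^-1 <= y -> 3 / 4 <= h x y.
Proof. by move=> *; rewrite /pow_quot; case: ifP => _; nra. Qed.

Lemma pow_quot_lip x x' y : 0 <= x <= 1 -> 0 <= x' <= 1 -> 0 <= y <= 1 ->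
  `|h x y - h x' y| <= 3 * `|x - x'|.
Proof.
move=> /andP[??] /andP[??] /andP[??]; rewrite /pow_quot; case: ifP => _.
  have -> : x + y - (x' + y) = x - x' by ring.
  by have := normr_ge0 (x - x'); lra.
have -> : x ^+ 2 + x * y + y ^+ 2 - (x' ^+ 2 + x' * y + y ^+ 2) =
  (x + x' + y) * (x - x') by ring.
by rewrite normrM ler_wpM2r // ger0_norm; lra.
Qed.

Lemma pow_quot_lt x x' y : 0 <= x -> x < x' -> 0 <= y -> h x y < h x' y.
Proof. by move=> *; rewrite /pow_quot; case: ifP => _; nra. Qed.

Definition fermat_arc u v := [/\ 0 <= u <= 1, 0 <= v <= 1 & u ^+ n + v ^+ n = 1].

Lemma fermat_arc_chord u v u' v' : u ^+ n + v ^+ n = 1 -> u' ^+ n + v' ^+ n = 1 ->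
  (v - v') * h v v' = - ((u - u') * h u u').
Proof.
move=> e e'; rewrite -!subX_pow_quot.
have -> : v ^+ n = 1 - u ^+ n by rewrite -e; ring.
have -> : v' ^+ n = 1 - u' ^+ n by rewrite -e'; ring.
by ring.
Qed.

(** By [fermat_arc_chord] each v-difference is minus the u-difference times a quotient of values of
    [h]. The determinant thus splits into two u-differences and a difference of slopes, the form
    used both to bound it and to show that it is nonzero. *)
Lemma fermat_arc_det u1 v1 u2 v2 u3 v3 :
    u1 ^+ n + v1 ^+ n = 1 -> u2 ^+ n + v2 ^+ n = 1 -> u3 ^+ n + v3 ^+ n = 1 ->
  ((u2 - u1) * (v3 - v1) - (u3 - u1) * (v2 - v1)) * (h v2 v1 * h v3 v1) =
  (u2 - u1) * (u3 - u1) * (h u2 u1 * h v3 v1 - h u3 u1 * h v2 v1).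
Proof.
move=> e1 e2 e3.
have c2 := fermat_arc_chord e2 e1; have c3 := fermat_arc_chord e3 e1.
transitivity ((u2 - u1) * h v2 v1 * ((v3 - v1) * h v3 v1) -
   (u3 - u1) * h v3 v1 * ((v2 - v1) * h v2 v1)); first by ring.
by rewrite c2 c3; ring.
Qed.

(** Each of the three factors in [fermat_arc_det] is O(d); v >= 1/2 keeps the slopes bounded, as the
    values [h v v'] are then at least 3/4. The last factor is at most 3 * 3 * 4 d + 3 d * 3 = 45 d,
    and 45 / (3/4)^2 = 80. *)
Lemma fermat_arc_det_le d u1 v1 u2 v2 u3 v3 :
    fermat_arc u1 v1 -> fermat_arc u2 v2 -> fermat_arc u3 v3 ->
    2^-1 <= v1 -> 2^-1 <= v2 -> 2^-1 <= v3 ->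
    `|u2 - u1| <= d -> `|u3 - u1| <= d -> `|u3 - u2| <= d ->
  `|(u2 - u1) * (v3 - v1) - (u3 - u1) * (v2 - v1)| <= 80 * d ^+ 3.
Proof.
move=> [u1I v1I e1] [u2I v2I e2] [u3I v3I e3] v1g v2g v3g d21 d31 d32.
have d0 : 0 <= d by apply: le_trans d21.
have v32 : `|v3 - v2| <= 4 * d.
  have := fermat_arc_chord e3 e2 => /(congr1 Num.norm).
  rewrite normrN !normrM.
  rewrite (ger0_norm (pow_quot_ge0 _ _)); [|lra..].
  rewrite (ger0_norm (pow_quot_ge0 _ _)); [|lra..].
  have := pow_quot_ge v3g v2g; have := pow_quot_le u3I u2I.
  have := normr_ge0 (v3 - v2); have := normr_ge0 (u3 - u2).
  by nra.
have := fermat_arc_det e1 e2 e3 => /(congr1 Num.norm).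
set D := (X in `|X * _| = _); rewrite !normrM.
have g2 := pow_quot_ge v2g v1g; have g3 := pow_quot_ge v3g v1g.
rewrite (@ger0_norm _ (h v2 v1)); last lra.
rewrite (@ger0_norm _ (h v3 v1)); last lra.
set N := h u2 u1 * _ - _ => eD.
have Nle : `|N| <= 45 * d.
  have -> : N = h u2 u1 * (h v3 v1 - h v2 v1) + (h u2 u1 - h u3 u1) * h v2 v1.
    by rewrite /N; ring.
  apply: le_trans (ler_normD _ _) _; rewrite !normrM.
  have -> : 45 * d = 3 * (3 * (4 * d)) + (3 * d) * 3 by ring.
  apply: lerD; apply: ler_pM => //.
  - by rewrite ger0_norm ?pow_quot_le // pow_quot_ge0 //; lra.
  - apply: le_trans (pow_quot_lip _ _ _) _ => //.
    by rewrite ler_wpM2l.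
  - apply: le_trans (pow_quot_lip _ _ _) _ => //.
    by rewrite ler_wpM2l // distrC.
  - by rewrite ger0_norm ?pow_quot_le //; lra.
have : `|D| * (3 / 4 * (3 / 4)) <= d * d * (45 * d).
  apply: (@le_trans _ _ (`|D| * (h v2 v1 * h v3 v1))).
    by rewrite ler_wpM2l // ler_pM //; lra.
  by rewrite eD !ler_pM // mulr_ge0.
have -> : d ^+ 3 = d * d * d by ring.
set t := d * d; have -> : t * (45 * d) = 45 * (t * d) by ring.
by lra.
Qed.

(* The open arc [u ^ n + v ^ n = 1] is strictly concave. *)
Lemma fermat_arc_det_neq0 u1 v1 u2 v2 u3 v3 :
    u1 ^+ n + v1 ^+ n = 1 -> u2 ^+ n + v2 ^+ n = 1 -> u3 ^+ n + v3 ^+ n = 1 ->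
    0 < u1 -> 0 < u2 -> 0 < u3 -> 0 < v1 -> 0 < v2 -> 0 < v3 ->
    u1 != u2 -> u1 != u3 -> u2 != u3 ->
  (u2 - u1) * (v3 - v1) - (u3 - u1) * (v2 - v1) != 0.
Proof.
(* Exchanging the last two points only changes the sign of the determinant. *)
wlog u23 : u2 v2 u3 v3 / u2 < u3 => [hw|].
  move=> e1 e2 e3 u1p u2p u3p v1p v2p v3p n12 n13 n23'.
  have [lt|gt|/eqP] := ltgtP u2 u3; last by rewrite (negPf n23').
    exact: hw.
  rewrite -oppr_eq0 opprB; apply: hw => //.
  by rewrite eq_sym.
move=> e1 e2 e3 u1p u2p u3p v1p v2p v3p n12 n13 _.
have v32 : v3 < v2.
  have := fermat_arc_chord e3 e2.
  by have := pow_quot_gt0 v3p v2p; have := pow_quot_gt0 u3p u2p; nra.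
suff : (u2 - u1) * (u3 - u1) * (h u2 u1 * h v3 v1 - h u3 u1 * h v2 v1) != 0.
  by rewrite -(fermat_arc_det e1 e2 e3) mulf_eq0 negb_or => /andP[].
rewrite !mulf_neq0 ?subr_eq0 1?eq_sym //.
(* As u2 < u3 and v3 < v2, both factors of the first product are strictly smaller than those of the
   second. *)
rewrite gt_eqF // ltr_pM ?pow_quot_lt ?ltW //.
- exact: pow_quot_gt0.
- exact: pow_quot_gt0.
Qed.

End FermatCurve.

Lemma nth_root_exists (R : realType) (n : nat) (t : R) : (0 < n)%N -> 0 < t ->
  exists2 k : R, 0 < k & k ^+ n = t.
Proof.
move=> n0 t0; exists (t `^ n%:R^-1); first exact: powR_gt0.
rewrite -powR_mulrn ?powR_ge0 // -powRrM mulVf ?pnatr_eq0 -?lt0n //.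
by rewrite powRr1 // ltW.
Qed.

Lemma truncn_eq_dist (R : realType) (k u v : R) : 0 < k -> 0 <= u -> 0 <= v ->
  Num.truncn (k * u) = Num.truncn (k * v) -> `|u - v| <= k^-1.
Proof.
move=> k0 u0 v0 e.
have /andP[u1 u2] := truncn_itv (mulr_ge0 (ltW k0) u0).
have /andP[v1 v2] := truncn_itv (mulr_ge0 (ltW k0) v0).
rewrite e in u1 u2; rewrite -addn1 natrD in u2 v2.
rewrite -(ler_pM2l k0) divff ?gt_eqF // -{1}(gtr0_norm k0) -normrM mulrBr.
by rewrite ler_norml; apply/andP; split; lra.
Qed.

(** * Integer solutions as points on short arcs *)

Definition fermat_sol (n a b c N : nat) (r : nat * nat * nat) : bool :=
  let: (x, y, z) := r in
  [&& (0 < x)%N, (0 < y)%N, (0 < z)%N, (a * x ^ n + b * y ^ n == c * z ^ n)%N,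
      (c * z ^ n <= N)%N & coprime (a * x ^ n) (b * y ^ n)].

Definition det3 (r1 r2 r3 : nat * nat * nat) : int :=
  let: (x1, y1, z1) := r1 in
  let: (x2, y2, z2) := r2 in
  let: (x3, y3, z3) := r3 in
  z1%:Z * (x2%:Z * y3%:Z - x3%:Z * y2%:Z) -
  z2%:Z * (x1%:Z * y3%:Z - x3%:Z * y1%:Z) +
  z3%:Z * (x1%:Z * y2%:Z - x2%:Z * y1%:Z).

Lemma fermat_sol_coprime n a b c N x y z : (0 < n)%N ->
    fermat_sol n a b c N (x, y, z) ->
  [/\ coprime a b, coprime a c, coprime b c, coprime x z &
      [/\ coprime a y, coprime a z, coprime b x, coprime b z &
          coprime c x /\ coprime c y]].
Proof.
move=> n0 /and5P[_ _ _ /eqP e /andP[_ cPQ]].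
have cPW : coprime (a * x ^ n) (c * z ^ n).
  by rewrite -e /coprime gcdnDl.
have cQW : coprime (b * y ^ n) (c * z ^ n).
  by rewrite -e /coprime gcdnDr gcdnC.
move: cPQ cPW cQW; rewrite !coprimeMl !coprimeMr !coprime_pexpl // !coprime_pexpr //.
move=> /andP[/andP[ab ay] /andP[xb xy]] /andP[/andP[ac az] /andP[xc xz]].
move=> /andP[/andP[bc bz] /andP[yc yz]].
by split=> //; split=> //; rewrite coprime_sym // (coprime_sym c).
Qed.

(** Expanding along the column absent from the congruences makes every 2 x 2 minor, once multiplied
    by n, divisible by m. *)
Lemma dvdz_det3 (n m : nat) (r1 r2 r3 : nat * nat * nat) :
  let X (r : nat * nat * nat) := r.1.1%:Z in
  let Y (r : nat * nat * nat) := r.1.2%:Z in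
  let Z (r : nat * nat * nat) := r.2%:Z in
  let cross (U V : nat * nat * nat -> int) r r' :=
    (m %| n%:Z * (U r * V r' - U r' * V r))%Z in
  let cross3 U V := [/\ cross U V r1 r2, cross U V r1 r3 & cross U V r2 r3] in
  [\/ cross3 X Y, cross3 Y Z | cross3 X Z] -> (m %| n%:Z * det3 r1 r2 r3)%Z.
Proof.
move: r1 r2 r3 => [[x1 y1] z1] [[x2 y2] z2] [[x3 y3] z3] /=.
set N := n%:Z.
have combine (A B C z z' z'' : int) : (m %| N * A)%Z -> (m %| N * B)%Z ->
    (m %| N * C)%Z -> (m %| N * A * z - N * B * z' + N * C * z'')%Z.
  by move=> ? ? ?; rewrite rpredD ?rpredB // dvdz_mulr.
case=> -[h12 h13 h23].
- have := combine _ _ _ z3%:Z z2%:Z z1%:Z h12 h13 h23.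
  by congr (_ %| _)%Z; ring.
- have := combine _ _ _ x3%:Z x2%:Z x1%:Z h12 h13 h23.
  by congr (_ %| _)%Z; ring.
- have := combine _ _ _ (- y3%:Z) (- y2%:Z) (- y1%:Z) h12 h13 h23.
  by congr (_ %| _)%Z; ring.
Qed.

(** The fraction x / z is in lowest terms and so fixes x and z; the equation then fixes y. Hence
    distinct solutions have distinct abscissae on the real curve. *)
Lemma fermat_sol_inj n a b c N (r r' : nat * nat * nat) : (0 < n)%N ->
    (0 < b)%N -> fermat_sol n a b c N r -> fermat_sol n a b c N r' ->
  (r.1.1 * r'.2 = r'.1.1 * r.2)%N -> r = r'.
Proof.
move: r r' => [[x y] z] [[x' y'] z'] n0 b0 s s' /= e.
have [_ _ _ cxz _] := fermat_sol_coprime n0 s.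
have [_ _ _ cxz' _] := fermat_sol_coprime n0 s'.
have xx' : x = x'.
  apply/eqP; rewrite eqn_dvd; apply/andP; split.
    by rewrite -(Gauss_dvdl _ cxz) -e dvdn_mulr.
  by rewrite -(Gauss_dvdl _ cxz') e dvdn_mulr.
have x'0 : (0 < x')%N by case/and3P: s'.
have zz' : z = z'.
  by move/eqP: e; rewrite xx' eqn_pmul2l // => /eqP.
move: s s' => /and5P[_ _ _ /eqP E _] /and5P[_ _ _ /eqP E' _].
have /eqP : (b * y ^ n = b * y' ^ n)%N by move: E E'; rewrite xx' zz'; lia.
by rewrite xx' zz' eqn_pmul2l // eqn_exp2r // => /eqP ->.
Qed.

(** With k ^ n = c / a and l ^ n = c / b, the points (x / (k z), y / (l z)) lie on u ^ n + v ^ n =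
    1, and [det3] of three solutions is k l z1 z2 z3 times the determinant of their points. The
    latter is at most 80 / K ^ 3 on a common arc, and c z ^ n <= N bounds the z's. *)
Lemma fermat_sol_arcs (R : realType) n a b c N K : (n == 2%N) || (n == 3%N) ->
    (0 < a)%N -> (0 < b)%N -> (0 < c)%N -> (0 < K)%N ->
  exists2 arc : nat * nat * nat -> bool * nat,
    forall r, fermat_sol n a b c N r -> ((arc r).2 <= K)%N &
    forall r1 r2 r3, fermat_sol n a b c N r1 -> fermat_sol n a b c N r2 ->
      fermat_sol n a b c N r3 -> r1 != r2 -> r1 != r3 -> r2 != r3 ->
      arc r1 = arc r2 -> arc r1 = arc r3 ->
      det3 r1 r2 r3 != 0 /\
      (a * b * c * K ^ (3 * n) * `|det3 r1 r2 r3| ^ n <= 80 ^ n * N ^ 3)%N.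
Proof.
move=> n23 a0 b0 c0 K0.
have n0 : (0 < n)%N by case/orP: n23 => /eqP->.
have aR : 0 < a%:R :> R by rewrite ltr0n.
have bR : 0 < b%:R :> R by rewrite ltr0n.
have cR : 0 < c%:R :> R by rewrite ltr0n.
have KR : 0 < K%:R :> R by rewrite ltr0n.
have [k k0 kn] := nth_root_exists n0 (divr_gt0 cR aR).
have [l l0 ln] := nth_root_exists n0 (divr_gt0 cR bR).
pose u (r : nat * nat * nat) : R := r.1.1%:R / (k * r.2%:R).
pose v (r : nat * nat * nat) : R := r.1.2%:R / (l * r.2%:R).
have uv r : fermat_sol n a b c N r ->
    [/\ 0 < u r, 0 < v r, u r ^+ n + v r ^+ n = 1, u r <= 1 & v r <= 1].
  case: r => -[x y] z /and5P[x0 y0 z0 /eqP e _].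
  have xR : 0 < x%:R :> R by rewrite ltr0n.
  have yR : 0 < y%:R :> R by rewrite ltr0n.
  have zR : 0 < z%:R :> R by rewrite ltr0n.
  have u0 : 0 < u (x, y, z) by rewrite divr_gt0 ?mulr_gt0.
  have v0 : 0 < v (x, y, z) by rewrite divr_gt0 ?mulr_gt0.
  have uv1 : u (x, y, z) ^+ n + v (x, y, z) ^+ n = 1.
    rewrite /u /v /= !expr_div_n !exprMn kn ln.
    have : a%:R * x%:R ^+ n + b%:R * y%:R ^+ n = c%:R * z%:R ^+ n :> R.
      by rewrite -!natrX -!natrM -natrD e.
    have : z%:R ^+ n != 0 :> R by rewrite expf_neq0 ?gt_eqF.
    move: (x%:R ^+ n) (y%:R ^+ n) (z%:R ^+ n) => X Y Z Z0 E.
    have -> : Y = (c%:R * Z - a%:R * X) / b%:R.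
      by rewrite -E [a%:R * X + _]addrC addrK mulrC mulKf ?gt_eqF.
    by field; rewrite Z0 !gt_eqF.
  split=> //.
    rewrite -(expr_le1 n0 (ltW u0)) -uv1 lerDl.
    by rewrite exprn_ge0 ?ltW.
  rewrite -(expr_le1 n0 (ltW v0)) -uv1 lerDr.
  by rewrite exprn_ge0 ?ltW.
(* One of u ^ n and v ^ n is at least 1/2. The flag tells which, and the curve is cut along the
   other coordinate into cells of length 1 / K. *)
pose arc r := if u r ^+ n <= 2^-1 then (false, Num.truncn (K%:R * u r))
              else (true, Num.truncn (K%:R * v r)).
have trK (t : R) : 0 < t -> t <= 1 -> (Num.truncn (K%:R * t) <= K)%N.
  move=> t0 t1; rewrite leqNgt; apply/negP => h.
  have h1 : K.+1%:R <= K%:R * t by rewrite -truncn_gt_nat.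
  have : K.+1%:R <= K%:R :> R by apply: le_trans h1 _; rewrite ler_piMr // ltW.
  by rewrite ler_nat ltnn.
exists arc => [r /uv[u0 v0 _ u1 v1]|r1 r2 r3 s1 s2 s3 n12 n13 n23'].
  by rewrite /arc; case: ifP => _; apply: trK.
have [u10 v10 e1 u11 v11] := uv _ s1.
have [u20 v20 e2 u21 v21] := uv _ s2.
have [u30 v30 e3 u31 v31] := uv _ s3.
pose D := (u r2 - u r1) * (v r3 - v r1) - (u r3 - u r1) * (v r2 - v r1).
have half (t : R) : 0 < t -> t <= 1 -> 2^-1 <= t ^+ n -> 2^-1 <= t.
  move=> t0 t1 th; apply: (le_trans th); rewrite -[leRHS]expr1.
  by apply: ler_wiXn2l => //; apply: ltW.
have arcP r r' : fermat_sol n a b c N r -> fermat_sol n a b c N r' ->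
    arc r = arc r' ->
    if u r ^+ n <= 2^-1 then
      [/\ 2^-1 <= v r, 2^-1 <= v r' & `|u r' - u r| <= K%:R^-1]
    else [/\ 2^-1 <= u r, 2^-1 <= u r' & `|v r' - v r| <= K%:R^-1].
  move=> /uv[ur vr er ur1 vr1] /uv[ur' vr' er' ur'1 vr'1].
  rewrite /arc; case: ifPn => cu; case: ifPn => cu' // [e].
    split; [apply: half => //; lra|apply: half => //; lra|].
    by rewrite distrC; apply: truncn_eq_dist => //; rewrite ltW.
  rewrite -ltNge in cu; rewrite -ltNge in cu'.
  split; [apply: half => //; lra|apply: half => //; lra|].
  by rewrite distrC; apply: truncn_eq_dist => //; rewrite ltW.
move=> a12 a13.
have A12 := arcP _ _ s1 s2 a12.
have A13 := arcP _ _ s1 s3 a13.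
have A23 := arcP _ _ s2 s3 (etrans (esym a12) a13).
have cas : (u r2 ^+ n <= 2^-1) = (u r1 ^+ n <= 2^-1).
  by move: a12; rewrite /arc; do 2 case: ifP.
rewrite cas in A23.
have Dle : `|D| <= 80 * K%:R^-1 ^+ 3.
  move: A12 A13 A23; case: ifP => _ [? ? ?] [? ? ?] [? ? ?].
    by apply: (@fermat_arc_det_le R n n23) => //; split=> //; apply/andP; split=> //; apply: ltW.
  (* On the other half u and v exchange roles, which reverses the sign of [D]. *)
  rewrite /D -normrN opprB [X in `|X - _|]mulrC [X in `|_ - X|]mulrC.
  apply: (@fermat_arc_det_le R n n23) => //; split=> //;
    by [apply/andP; split=> //; apply: ltW|rewrite addrC].
have neq_u r r' : fermat_sol n a b c N r -> fermat_sol n a b c N r' ->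
    r != r' -> u r != u r'.
  move=> s s' nrr'; apply: contra nrr' => /eqP; rewrite /u => E.
  apply/eqP; apply: (fermat_sol_inj n0 b0 s s').
  move: s s' E; case: r => -[x y] z; case: r' => -[x' y'] z' /=.
  case/and5P=> [_ _ z0 _ _] /and5P[_ _ z0' _ _] /eqP.
  have kz w : (0 < w)%N -> k * w%:R != 0 by move=> w0; rewrite gt_eqF // mulr_gt0 ?ltr0n.
  rewrite eqr_div ?kz // !(mulrCA _ k) (inj_eq (mulfI (lt0r_neq0 k0))).
  by rewrite -!natrM eqr_nat => /eqP.
have D0 : D != 0 by apply: (@fermat_arc_det_neq0 R n n23) => //; apply: neq_u.
have detE : (det3 r1 r2 r3)%:~R = k * l * (r1.2%:R * r2.2%:R * r3.2%:R) * D.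
  rewrite /D /u /v.
  move: s1 s2 s3; clear -k0 l0.
  case: r1 => -[x1 y1] z1; case: r2 => -[x2 y2] z2; case: r3 => -[x3 y3] z3 /=.
  case/and5P=> [_ _ z10 _ _] /and5P[_ _ z20 _ _] /and5P[_ _ z30 _ _].
  rewrite !rmorphD !rmorphN !rmorphM !rmorphD !rmorphN !rmorphM /= -!pmulrn.
  by field; rewrite !gt_eqF ?ltr0n.
have zR r : fermat_sol n a b c N r ->
    0 < r.2%:R :> R /\ c%:R * r.2%:R ^+ n <= N%:R :> R.
  case: r => -[x y] z /and5P[_ _ z0 _ /andP[zN _]] /=.
  by rewrite ltr0n -natrX -natrM ler_nat.
have [z10 z1N] := zR _ s1; have [z20 z2N] := zR _ s2; have [z30 z3N] := zR _ s3.
split.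
  by rewrite -(intr_eq0 R) detE !mulf_neq0 // lt0r_neq0.
rewrite -(ler_nat R) !natrM !natrX natr_absz intr_norm detE.
rewrite !normrM (gtr0_norm k0) (gtr0_norm l0) (gtr0_norm z10) (gtr0_norm z20).
rewrite (gtr0_norm z30) !exprMn kn ln.
set Z1 := r1.2%:R ^+ n; set Z2 := r2.2%:R ^+ n; set Z3 := r3.2%:R ^+ n.
have -> : a%:R * b%:R * c%:R * K%:R ^+ (3 * n) *
    (c%:R / a%:R * (c%:R / b%:R) * (Z1 * Z2 * Z3) * `|D| ^+ n) =
    (K%:R ^+ 3 * `|D|) ^+ n * ((c%:R * Z1) * (c%:R * Z2) * (c%:R * Z3)).
  rewrite exprMn -exprM; move: (K%:R ^+ _) (`|D| ^+ n) => ? ?.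
  by field; rewrite !gt_eqF.
have Z10 : 0 < Z1 by rewrite exprn_gt0.
have Z20 : 0 < Z2 by rewrite exprn_gt0.
have Z30 : 0 < Z3 by rewrite exprn_gt0.
apply: ler_pM.
- by rewrite exprn_ge0 // mulr_ge0 // exprn_ge0 // ltW.
- by rewrite !mulr_ge0 // ltW.
- apply: lerXn2r; rewrite ?nnegrE //.
  rewrite -(@ler_pM2l _ (K%:R^-1 ^+ 3)) ?exprn_gt0 ?invr_gt0 //.
  rewrite mulrA -exprMn mulVf ?gt_eqF // expr1n mul1r.
  by rewrite mulrC.
- rewrite [leRHS]mulrA.
  have cZ (Z : R) : 0 < Z -> 0 <= c%:R * Z by move=> Z0; rewrite mulr_ge0 // ltW.
  have := cZ _ Z10; have := cZ _ Z20; have := cZ _ Z30 => c3 c2 c1.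
  by apply: ler_pM => //; [exact: mulr_ge0|exact: ler_pM].
Qed.

(** * Solutions with fixed coefficients *)

Lemma size_le_sum_fibres (T L : eqType) (f : T -> L) (s : seq T) (ls : seq L) :
    {in s, forall r, f r \in ls} ->
  (size s <= \sum_(l <- ls) size [seq r <- s | f r == l])%N.
Proof.
elim: ls s => [|l ls IH] s fs.
  by case: s fs => // r s /(_ r (mem_head _ _)).
rewrite big_cons -(count_predC (fun r => f r == l)) -!size_filter leq_add2l.
apply: (@leq_trans (\sum_(l' <- ls)
  size [seq r <- [seq r <- s | f r != l] | f r == l'])%N).
  by apply: IH => r; rewrite mem_filter => /andP[/negPf frl /fs]; rewrite inE frl.
apply: leq_sum => l' _; rewrite -filter_predI !size_filter.
by apply: sub_count => r /= /andP[].
Qed.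

Lemma mem_pairs (S T : eqType) (s : seq S) (t : seq T) x y :
  x \in s -> y \in t -> (x, y) \in [seq (p, q) | p <- s, q <- t].
Proof. exact: allpairs_f. Qed.

Lemma size_uniq_le2 (T : eqType) (s : seq T) : uniq s ->
    (forall r1 r2 r3, r1 \in s -> r2 \in s -> r3 \in s ->
      r1 != r2 -> r1 != r3 -> r2 != r3 -> False) ->
  (size s <= 2)%N.
Proof.
case: s => [|r1 [|r2 [|r3 s]]] //= /and3P[].
rewrite !inE !negb_or => /and3P[n12 n13 _] /andP[n23 _] _ H.
by case: (H r1 r2 r3); rewrite // !inE eqxx ?orbT.
Qed.

(** The n-th powers of u / v and u' / v' are both B / A modulo m. *)
Lemma dvdz_cross_pow (n m : nat) (A B u v u' v' : int) : coprime m `|A| ->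
    (m %| A * u ^+ n - B * v ^+ n)%Z -> (m %| A * u' ^+ n - B * v' ^+ n)%Z ->
  (m %| (u * v') ^+ n - (u' * v) ^+ n)%Z.
Proof.
move=> mA d d'; rewrite -(@Gauss_dvdzr _ A) // !exprMn.
have -> : A * (u ^+ n * v' ^+ n - u' ^+ n * v ^+ n) =
  (A * u ^+ n - B * v ^+ n) * v' ^+ n - (A * u' ^+ n - B * v' ^+ n) * v ^+ n.
  by ring.
by rewrite rpredB // dvdz_mulr.
Qed.

Lemma dvdz_cross_mod (d x y x' y' : nat) : (x %% d = x' %% d)%N ->
  (y %% d = y' %% d)%N -> (d %| x%:Z * y'%:Z - x'%:Z * y%:Z)%Z.
Proof.
move=> ex ey; rewrite -eqz_mod_dvd -!PoszM !modz_nat eqz_nat.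
by rewrite -(modnMm x y') -(modnMm x' y) ex ey.
Qed.

(** For three distinct solutions with a common label, n times [det3] is nonzero and divisible by
    abc, against the arc bound; so a label has at most two solutions. The divisors a', b', c' carry
    the same primes as a, b, c, and keep the labels few when the coefficients are powers. *)
Lemma fermat_sol_count (R : realType) (n a b c a' b' c' N K : nat)
    (s : seq (nat * nat * nat)) :
    (n == 2%N) || (n == 3%N) ->
    (0 < a)%N -> (0 < b)%N -> (0 < c)%N -> (0 < K)%N ->
    (a' %| a)%N -> (b' %| b)%N -> (c' %| c)%N ->
    (forall p, prime p -> (p %| a)%N -> (p %| a')%N) ->
    (forall p, prime p -> (p %| b)%N -> (p %| b')%N) ->
    (forall p, prime p -> (p %| c)%N -> (p %| c')%N) ->
    uniq s -> {in s, forall r, fermat_sol n a b c N r} ->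
    ((80 * n) ^ n * N ^ 3 < (a * b * c) ^ n.+1 * K ^ (3 * n))%N ->
  (size s <= 2 * (size (divisor_chains a') * size (divisor_chains b') *
    size (divisor_chains c') * (4 * 4 * 4) * (2 * K.+1)))%N.
Proof.
move=> n23 a0 b0 c0 K0 aa bb cc pa pb pc us sol small.
have n0 : (0 < n)%N by case/orP: n23 => /eqP->.
pose X (r : nat * nat * nat) := r.1.1%:Z.
pose Y (r : nat * nat * nat) := r.1.2%:Z.
pose Z (r : nat * nat * nat) := r.2%:Z.
have cop r : r \in s -> [/\ coprime a b, coprime a c, coprime b c,
     [/\ coprime a (absz (Y r)), coprime a (absz (Z r)), coprime b (absz (X r)) &
      coprime b (absz (Z r))] & coprime c (absz (X r)) /\ coprime c (absz (Y r))].
  move=> /sol; case: r => -[x y] z sr.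
  by have [? ? ? _ [? ? ? ? ?]] := fermat_sol_coprime n0 sr.
have eqn r : r \in s ->
    a%:Z * X r ^+ n + b%:Z * Y r ^+ n = c%:Z * Z r ^+ n.
  move=> /sol; case: r => -[x y] z /and5P[_ _ _ /eqP e _].
  by rewrite /X /Y /Z /= -!rmorphXn /= -!PoszM -PoszD e.
have [fc fcP fcD] : exists2 f : nat * nat * nat -> nat * nat,
    {in s, forall r, f r \in divisor_chains c'} &
    {in s &, forall r r', f r = f r' ->
      (n = 2%N -> (4 %| X r * Y r' - X r' * Y r)%Z) ->
      (c %| n%:Z * (X r * Y r' - X r' * Y r))%Z}.
  apply: exists_ratio_label => // [r /cop[_ _ _ _ [-> ->]] //|r r' rs r's].
  have [_ ac _ _ _] := cop r rs.
  apply: (@dvdz_cross_pow _ _ a%:Z (- b%:Z)); first by rewrite coprime_sym.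
    by rewrite mulNr opprK eqn // dvdz_mulr.
  by rewrite mulNr opprK eqn // dvdz_mulr.
have [fa faP faD] : exists2 f : nat * nat * nat -> nat * nat,
    {in s, forall r, f r \in divisor_chains a'} &
    {in s &, forall r r', f r = f r' ->
      (n = 2%N -> (4 %| Y r * Z r' - Y r' * Z r)%Z) ->
      (a %| n%:Z * (Y r * Z r' - Y r' * Z r))%Z}.
  apply: exists_ratio_label => // [r /cop[_ _ _ [-> ->] _] //|r r' rs r's].
  have [ab _ _ _ _] := cop r rs.
  have H u : u \in s -> (a %| b%:Z * Y u ^+ n - c%:Z * Z u ^+ n)%Z.
    by move=> us'; rewrite -eqn // opprD addrCA subrr addr0 rpredN dvdz_mulr.
  by apply: (@dvdz_cross_pow _ _ b%:Z c%:Z) => //; apply: H.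
have [fb fbP fbD] : exists2 f : nat * nat * nat -> nat * nat,
    {in s, forall r, f r \in divisor_chains b'} &
    {in s &, forall r r', f r = f r' ->
      (n = 2%N -> (4 %| X r * Z r' - X r' * Z r)%Z) ->
      (b %| n%:Z * (X r * Z r' - X r' * Z r))%Z}.
  apply: exists_ratio_label => // [r /cop[_ _ _ [_ _ -> ->] _] //|r r' rs r's].
  have [ab _ _ _ _] := cop r rs.
  have H u : u \in s -> (b %| a%:Z * X u ^+ n - c%:Z * Z u ^+ n)%Z.
    by move=> us'; rewrite -eqn // opprD addrA subrr sub0r rpredN dvdz_mulr.
  apply: (@dvdz_cross_pow _ _ a%:Z c%:Z); [by rewrite coprime_sym|exact: H|exact: H].
have [arc arcK arcP] := @fermat_sol_arcs R n a b c N K n23 a0 b0 c0 K0.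
(* For n = 2, [exists_ratio_label] asks for cross products divisible by 4; equal residues modulo 4
   provide this. *)
pose m4 (r : nat * nat * nat) := (r.1.1 %% 4, r.1.2 %% 4, r.2 %% 4)%N.
pose lab r := (fa r, fb r, fc r, m4 r, arc r).
pose I4 := iota 0 4.
pose ls := [seq (p, q) | p <- [seq (p, q) | p <-
  [seq (p, q) | p <- [seq (p, q) | p <- divisor_chains a', q <- divisor_chains b'],
     q <- divisor_chains c'], q <- [seq (p, q) | p <- [seq (p, q) | p <- I4, q <- I4], q <- I4]],
  q <- [seq (p, q) | p <- [:: true; false], q <- iota 0 K.+1]].
have -> : (size (divisor_chains a') * size (divisor_chains b') *
    size (divisor_chains c') * (4 * 4 * 4) * (2 * K.+1))%N = size ls.
  by rewrite /ls !size_allpairs size_iota.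
apply: (@leq_trans (\sum_(l <- ls) 2)); last first.
  by rewrite big_const_seq count_predT iter_addn_0.
apply: leq_trans (size_le_sum_fibres (f := lab) (ls := ls) _) _ => [r rs|].
  have m4I w : (w %% 4)%N \in I4 by rewrite mem_iota ltn_mod.
  have arcI : arc r \in [seq (p, q) | p <- [:: true; false], q <- iota 0 K.+1].
    have := arcK _ (sol _ rs); case: (arc r) => i j /= jK.
    have iI : i \in [:: true; false] by case: i.
    have jI : j \in iota 0 K.+1 by rewrite mem_iota add0n ltnS.
    exact: (mem_pairs iI jI).
  exact: (mem_pairs (mem_pairs (mem_pairs (mem_pairs (faP _ rs) (fbP _ rs))
    (fcP _ rs)) (mem_pairs (mem_pairs (m4I _) (m4I _)) (m4I _))) arcI).
apply: leq_sum => l _; apply: size_uniq_le2; first exact: filter_uniq.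
move=> r1 r2 r3; rewrite !mem_filter.
move=> /andP[/eqP l1 s1] /andP[/eqP l2 s2] /andP[/eqP l3 s3] n12 n13 n23'.
have [det0 detle] : det3 r1 r2 r3 != 0 /\
    (a * b * c * K ^ (3 * n) * `|det3 r1 r2 r3| ^ n <= 80 ^ n * N ^ 3)%N.
  apply: arcP => //; try exact: sol.
    by move: l1; rewrite -l2 => -[].
  by move: l1; rewrite -l3 => -[].
have same r r' : r \in s -> r' \in s -> lab r = lab r' ->
   [/\ (c %| n%:Z * (X r * Y r' - X r' * Y r))%Z,
       (a %| n%:Z * (Y r * Z r' - Y r' * Z r))%Z &
       (b %| n%:Z * (X r * Z r' - X r' * Z r))%Z].
  move=> rs r's [ea eb ec ex ey ez _].
  by split; [apply: fcD|apply: faD|apply: fbD] => // _; apply: dvdz_cross_mod.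
have [c12 a12 b12] := same _ _ s1 s2 (etrans l1 (esym l2)).
have [c13 a13 b13] := same _ _ s1 s3 (etrans l1 (esym l3)).
have [c23 a23 b23] := same _ _ s2 s3 (etrans l2 (esym l3)).
have da : (a %| n%:Z * det3 r1 r2 r3)%Z by apply: dvdz_det3; apply: Or32.
have db : (b %| n%:Z * det3 r1 r2 r3)%Z by apply: dvdz_det3; apply: Or33.
have dc : (c %| n%:Z * det3 r1 r2 r3)%Z by apply: dvdz_det3; apply: Or31.
have [ab ac bc _ _] := cop _ s1.
have dvd : (a * b * c %| n * `|det3 r1 r2 r3|)%N.
  move: da db dc; rewrite !dvdzE !abszM /= => da db dc.
  by rewrite !Gauss_dvd ?da ?db ?dc // coprimeMl ac.
have le : (a * b * c <= n * `|det3 r1 r2 r3|)%N.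
  by rewrite dvdn_leq // muln_gt0 n0 absz_gt0.
move: small; rewrite ltnNge => /negP; apply.
(* The n-th power of abc <= n |det3|, combined with the arc bound, contradicts the lower bound
   assumed on K. *)
have le' : ((a * b * c) ^ n <= (n * `|det3 r1 r2 r3|) ^ n)%N by rewrite leq_exp2r.
apply: (@leq_trans (a * b * c * K ^ (3 * n) * (n * `|det3 r1 r2 r3|) ^ n)).
  by rewrite expnS -mulnA [((_ ^ n) * _)%N]mulnC mulnA leq_mul2l le' orbT.
rewrite !expnMn mulnCA [(80 ^ n * _)%N]mulnC -[(n ^ n * _ * _)%N]mulnA.
by rewrite leq_mul2l detle orbT.
Qed.

(** * Squareful numbers and summation over the coefficients *)

(** Every exponent v >= 2 has the form 2 i + 3 j. The induction strips the full power of the least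
    prime factor, which leaves a squareful cofactor. *)
Lemma squareful_decomp (k : nat) : (0 < k)%N -> squareful k ->
  exists ab : nat * nat, k = (ab.1 ^ 2 * ab.2 ^ 3)%N.
Proof.
elim/ltn_ind: k => k IH k0 sq.
have [k1|k1] := leqP k 1; first by exists (1, 1)%N; case: k k0 k1 {IH sq} => [|[]].
have p_pr := pdiv_prime k1; set p := pdiv k in p_pr.
have pk : (p %| k)%N := pdiv_dvd k.
have := sq _ p_pr pk; rewrite pfactor_dvdn //.
have [m pm kE] := pfactor_coprime p_pr k0.
move: kE; set v := logn p k => kE v2.
have m0 : (0 < m)%N by move: k0; rewrite kE muln_gt0 => /andP[].
have mk : (m < k)%N.
  by rewrite kE ltn_Pmulr // -(expn0 p) ltn_exp2l ?prime_gt1 // (leq_trans _ v2).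
have sqm : squareful m.
  move=> q q_pr qm; have qk : (q %| k)%N by rewrite kE dvdn_mulr.
  have cqp : coprime (q ^ 2) (p ^ v).
    rewrite coprimeXl // coprimeXr // prime_coprime // dvdn_prime2 //.
    by apply/eqP => qp; move: pm; rewrite -qp prime_coprime // qm.
  by rewrite -(Gauss_dvdl m cqp) -kE; apply: sq.
have [[a b] /= mE] := IH m mk m0 sqm.
have [i [j vE]] : exists i, exists j, v = (2 * i + 3 * j)%N.
  have := odd_double_half v; case: (odd v) => e; last by exists v./2, 0; lia.
  by exists (v./2 - 1)%N, 1%N; lia.
exists (a * p ^ i, b * p ^ j)%N => /=.
by rewrite kE mE vE expnD !expnMn -!expnM ![(2 * _)%N]mulnC ![(3 * _)%N]mulnC; lia.
Qed.

(** * Harmonic sums and divisor chains *)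

Definition harmonic_sum (R : realType) (N : nat) : R :=
  \sum_(1 <= i < N.+1) i%:R^-1.

Lemma harmonic_sum_le (R : realType) (N : nat) : (0 < N)%N ->
  harmonic_sum R N <= 1 + ln N%:R.
Proof.
case: N => // N _; elim: N => [|N IH].
  by rewrite /harmonic_sum big_nat1 invr1 ln1 addr0.
rewrite /harmonic_sum big_nat_recr //= -/(harmonic_sum R N.+1).
apply: le_trans (lerD IH (lexx _)) _; rewrite -addrA lerD2l.
have N0 : 0 < N.+1%:R :> R by rewrite ltr0n.
have N1 : 0 < N.+2%:R :> R by rewrite ltr0n.
(* The inequality ln (1 + t) <= t at t = - 1 / (N + 2) reads 1 / (N + 2) <= ln (N + 2) - ln (N +
   1). *)
have := @le_ln1Dx R (- N.+2%:R^-1).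
have -> : 1 + - N.+2%:R^-1 = N.+1%:R / N.+2%:R :> R.
  have E : N.+2%:R = N.+1%:R + 1 :> R by rewrite natr1.
  by rewrite E in N1 *; field; rewrite gt_eqF.
rewrite ltrN2 invf_lt1 // ltr1n ln_div ?posrE // => /(_ isT).
by rewrite lerBlDl -lerBrDr.
Qed.

(** Writing x = e k turns the left side into the sum of f e / (e k) over pairs with e k <= N;
    dropping this condition makes it a product. *)
Lemma sum_divisors_le (R : realType) (f : nat -> R) (N : nat) :
    (forall e, 0 <= f e) ->
  \sum_(1 <= x < N.+1) (\sum_(e <- divisors x) f e) / x%:R <=
  (\sum_(1 <= e < N.+1) f e / e%:R) * harmonic_sum R N.
Proof.
move=> f0; set I := index_iota 1 N.+1.
pose g x e k : R := if (x == e * k)%N then f e / (e * k)%:R else 0.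
have g0 x e k : 0 <= g x e k.
  by rewrite /g; case: ifP => // _; rewrite divr_ge0.
apply: (@le_trans _ _ (\sum_(x <- I) \sum_(e <- I) \sum_(k <- I) g x e k)).
  rewrite big_seq [leRHS]big_seq; apply: ler_sum => x.
  rewrite mem_index_iota => /andP[x0 xN].
  have I_div e : e \in divisors x -> e \in I.
    rewrite -dvdn_divisors // => ex; rewrite mem_index_iota.
    by rewrite (dvdn_gt0 x0 ex) (leq_ltn_trans (dvdn_leq x0 ex)).
  apply: (@le_trans _ _ (\sum_(e <- I | e \in divisors x) \sum_(k <- I) g x e k)).
    have -> : \sum_(e <- I | e \in divisors x) \sum_(k <- I) g x e k =
        \sum_(e <- divisors x) \sum_(k <- I) g x e k.
      rewrite -big_filter; apply: perm_big; apply: uniq_perm.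
      - by rewrite filter_uniq // iota_uniq.
      - exact: divisors_uniq.
      by move=> e; rewrite mem_filter; case: (boolP (e \in divisors x)) => //= /I_div.
    rewrite mulr_suml big_seq [leRHS]big_seq; apply: ler_sum => e ex.
    have eI := I_div e ex.
    rewrite -dvdn_divisors // in ex.
    have kI : (x %/ e)%N \in I.
      apply: I_div; rewrite -dvdn_divisors //.
      by apply/dvdnP; exists e; rewrite mulnC divnK.
    rewrite (bigD1_seq _ kI) ?iota_uniq //= {1}/g mulnC divnK // eqxx.
    by rewrite lerDl sumr_ge0.
  rewrite [leRHS](bigID (fun e => e \in divisors x)) /= lerDl.
  by apply: sumr_ge0 => e _; apply: sumr_ge0.
rewrite exchange_big /= mulr_suml big_seq [leRHS]big_seq; apply: ler_sum => e eI.
rewrite exchange_big /= mulr_sumr big_seq [leRHS]big_seq; apply: ler_sum => k kI.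
have fek : f e / (e * k)%:R = f e / e%:R * k%:R^-1.
  by rewrite natrM invfM mulrA.
have [ekI|ekI] := boolP ((e * k)%N \in I).
  rewrite (bigD1_seq _ ekI) ?iota_uniq //= {1}/g eqxx fek big1 ?addr0 //.
  by move=> x /negPf xek; rewrite /g xek.
rewrite big_seq big1 => [|x xI].
  by rewrite -fek divr_ge0.
by rewrite /g; case: eqP => // xek; rewrite -xek xI in ekI.
Qed.

(** The number of chains is an iterated divisor sum of 1, so [sum_divisors_le] applies twice and
    leaves a third harmonic sum. *)
Lemma sum_divisor_chains_le (R : realType) (N : nat) :
  \sum_(1 <= x < N.+1) (size (divisor_chains x))%:R / x%:R <=
  harmonic_sum R N ^+ 3.
Proof.
have H0 : 0 <= harmonic_sum R N by apply: sumr_ge0 => i _; rewrite invr_ge0.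
have E z : (size (divisor_chains z))%:R =
    \sum_(e <- divisors z) (\sum_(d <- divisors e) 1) :> R.
  rewrite size_allpairs_dep sumnE big_map natr_sum.
  by apply: eq_bigr => e _; rewrite -sum1_size natr_sum.
under eq_bigr do rewrite E.
apply: le_trans (sum_divisors_le _ _) _ => [e|].
  by apply: sumr_ge0.
rewrite exprSr ler_wpM2r //.
apply: le_trans (sum_divisors_le _ _) _ => //.
rewrite exprSr expr1 ler_wpM2r //.
by apply: ler_sum => i _; rewrite mul1r.
Qed.

(** * Summation over the bases of the coefficients *)

Lemma prime_dvd_self_pow (e g p : nat) : prime p -> (p %| g ^ e)%N -> (p %| g)%N.
Proof. by move=> p_pr; rewrite Euclid_dvdX // => /andP[]. Qed.

(* Compares the determinant bound with the modulus when [P] is the product of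
   the bases of the coefficients and [N ^ 3 <= T ^ 5], i.e. [T >= N ^ (3/5)]. *)
Lemma arc_number_large (n e N T P : nat) :
    (n == 2%N) && (e == 3%N) || (n == 3%N) && (e == 2%N) ->
    (N ^ 3 <= T ^ 5)%N -> (0 < P <= T)%N ->
  ((80 * n) ^ n * N ^ 3 <
   (P ^ e) ^ n.+1 * (240 * (T %/ P).+1) ^ (3 * n))%N.
Proof.
set M := 240%N; move=> ne NT /andP[P0 PT].
have T0 : (0 < T)%N := leq_trans P0 PT.
have M0 : (0 < M)%N by [].
(* The value 240 = 80 * 3 is what n = 3 requires. *)
have Mn : ((80 * n) ^ n <= M ^ 3)%N.
  apply: (@leq_trans (M ^ n)).
    by rewrite leq_exp2r; case/orP: ne => /andP[/eqP-> _].
  by rewrite leq_exp2l //; case/orP: ne => /andP[/eqP-> _].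
clearbody M; set K := (M * _)%N.
have W : (M * T < P * K)%N.
  by rewrite /K mulnCA ltn_pmul2l // mulnC ltn_ceil.
apply: leq_ltn_trans (leq_mul Mn NT) _.
case/orP: ne => /andP[/eqP-> /eqP->].
  apply: (@leq_trans ((P * K) ^ 6)); last first.
    rewrite expnMn -expnM leq_pmul2r; last by rewrite expn_gt0 /K muln_gt0 M0.
    by rewrite leq_pexp2l.
  apply: (@leq_ltn_trans ((M * T) ^ 6)); last by rewrite ltn_exp2r.
  by rewrite expnMn leq_mul // leq_pexp2l.
(* For n = 3 the right side has only P ^ 8 against K ^ 9; multiplying by T >= P supplies the missing
   factor. *)
rewrite -(ltn_pmul2l T0).
apply: (@leq_trans ((P * K) ^ 9)); last first.
  rewrite expnMn -expnM mulnA leq_pmul2r; last by rewrite expn_gt0 /K muln_gt0 M0.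
  by rewrite (expnS P 8) leq_pmul2r // expn_gt0 P0.
apply: (@leq_ltn_trans ((M * T) ^ 9)); last by rewrite ltn_exp2r.
rewrite expnMn mulnCA; apply: leq_mul; first by rewrite leq_pexp2l.
by rewrite -expnS leq_pexp2l.
Qed.

(* The constant: at most 2 solutions per label, 4 ^ 3 residues mod 4 and
   2 * (K + 1) arcs, where K + 1 <= 960 * T / P. *)
Lemma count_small_coefs (R : realType) (n e N T : nat) (g h : nat -> nat)
    (s : seq (nat * nat * nat)) :
    (n == 2%N) && (e == 3%N) || (n == 3%N) && (e == 2%N) ->
    (N ^ 3 <= T ^ 5)%N -> uniq s ->
    {in s, forall t, let: (x, y, z) := t in
      [/\ [/\ (0 < x)%N, (0 < y)%N & (0 < z)%N], (x + y)%N = z, (z <= N)%N,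
          coprime x y &
          [/\ x = (g x ^ e * h x ^ n)%N, y = (g y ^ e * h y ^ n)%N,
              z = (g z ^ e * h z ^ n)%N & (g x * g y * g z <= T)%N]]} ->
  (size s)%:R <= 256 * 960 * T%:R *
    (\sum_(1 <= x < N.+1) (size (divisor_chains x))%:R / x%:R) ^+ 3 :> R.
Proof.
move=> ne NT us sP.
have [C C0 CE] : exists2 C : R, 0 <= C & C = 256 * 960.
  exists (256 * 960); last reflexivity.
  by apply: mulr_ge0; exact: ler0n.
rewrite -CE.
have n23 : (n == 2%N) || (n == 3%N) by case/orP: ne => /andP[-> _]; rewrite ?orbT.
have n0 : (0 < n)%N by case/orP: n23 => /eqP->.
have e0 : (0 < e)%N by case/orP: ne => /andP[_ /eqP->].
set I := index_iota 1 N.+1.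
pose c x : R := (size (divisor_chains x))%:R / x%:R.
have c0 x : 0 <= c x by rewrite divr_ge0.
pose f (t : nat * nat * nat) := (g t.1.1, g t.1.2, g t.2).
pose ls := [seq (p, q) | p <- [seq (p, q) | p <- I, q <- I], q <- I].
have gI x : (0 < x <= N)%N -> x = (g x ^ e * h x ^ n)%N -> g x \in I.
  move=> /andP[x0 xN] xE; rewrite mem_index_iota ltnS.
  have /andP[gx hx] : (0 < g x ^ e)%N && (0 < h x ^ n)%N.
    by rewrite -muln_gt0 -xE.
  rewrite expn_gt0 -(negbK (e == 0%N)) -lt0n e0 orbF in gx.
  rewrite gx /=; apply: leq_trans xN; rewrite [leqRHS]xE.
  apply: leq_trans (leq_pmulr _ hx).
  by rewrite -[leqLHS]expn1 leq_pexp2l.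
have fls : {in s, forall t, f t \in ls}.
  move=> -[[x y] z] /sP[[x0 y0 z0] xyz zN _ [xE yE zE _]].
  have xN : (x <= N)%N by rewrite (leq_trans _ zN) // -xyz leq_addr.
  have yN : (y <= N)%N by rewrite (leq_trans _ zN) // -xyz leq_addl.
  have gx : g x \in I by apply: gI => //; rewrite x0.
  have gy : g y \in I by apply: gI => //; rewrite y0.
  have gz : g z \in I by apply: gI => //; rewrite z0.
  exact: (mem_pairs (mem_pairs gx gy) gz).
(* Fixing the bases p, q, r fixes the coefficients; the values of [h] then solve one equation, to
   which [fermat_sol_count] applies. *)
have fibre p q r : (size [seq t <- s | f t == (p, q, r)])%:R <=
    C * T%:R * (c p * c q * c r).
  case E : [seq t <- s | f t == (p, q, r)] => [|t0 s0].
    by rewrite !mulr_ge0.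
  rewrite -E; set s1 := [seq t <- s | _].
  have : t0 \in s1 by rewrite /s1 E mem_head.
  rewrite mem_filter => /andP[/eqP f0 /sP]; move: f0; case: t0 E => -[x0 y0] z0 E.
  move=> [gx0 gy0 gz0] [[x0p y0p z0p] _ _ _ [xE yE zE PT]].
  rewrite gx0 gy0 gz0 in xE yE zE PT.
  have pos w u : (0 < w)%N -> w = (u ^ e * h w ^ n)%N -> (0 < u)%N.
    by case: u => // w0 wE; move: w0; rewrite wE exp0n.
  have p0 := pos _ _ x0p xE; have q0 := pos _ _ y0p yE; have r0 := pos _ _ z0p zE.
  set P := (p * q * r)%N in PT.
  have P0 : (0 < P)%N by rewrite !muln_gt0 p0 q0.
  pose K := (240 * (T %/ P).+1)%N.
  pose m (t : nat * nat * nat) := (h t.1.1, h t.1.2, h t.2).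
  have s1P t : t \in s1 -> let: (x, y, z) := t in
    [/\ [/\ (0 < x)%N, (0 < y)%N & (0 < z)%N], (x + y)%N = z, (z <= N)%N,
        coprime x y & [/\ x = (p ^ e * h x ^ n)%N, y = (q ^ e * h y ^ n)%N &
              z = (r ^ e * h z ^ n)%N]].
    rewrite mem_filter; case: t => -[x y] z /andP[/eqP[gx gy gz] /sP].
    by rewrite gx gy gz => -[? ? ? ? [? ? ?]].
  have sz : (size s1 <= 2 * (size (divisor_chains p) * size (divisor_chains q) *
    size (divisor_chains r) * (4 * 4 * 4) * (2 * K.+1)))%N.
    rewrite -(size_map m).
    apply: (@fermat_sol_count R n (p ^ e) (q ^ e) (r ^ e) p q r N K) => //.
    - by rewrite expn_gt0 p0.
    - by rewrite expn_gt0 q0.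
    - by rewrite expn_gt0 r0.
    - by rewrite dvdn_exp.
    - by rewrite dvdn_exp.
    - by rewrite dvdn_exp.
    - exact: prime_dvd_self_pow.
    - exact: prime_dvd_self_pow.
    - exact: prime_dvd_self_pow.
    - rewrite map_inj_in_uniq ?filter_uniq // => -[[x y] z] [[x' y'] z'] t1 t2.
      move: (s1P _ t1) (s1P _ t2) => [_ _ _ _ [xE1 yE1 zE1]] [_ _ _ _ [xE2 yE2 zE2]].
      by case=> hx hy hz; rewrite xE1 yE1 zE1 hx hy hz -xE2 -yE2 -zE2.
    - move=> _ /mapP[[[x y] z] /s1P[[x1 y1 z1] xyz zN cxy [xE1 yE1 zE1]] ->] /=.
      rewrite -xE1 -yE1 -zE1 xyz eqxx zN cxy /= !andbT.
      have hpos w u : (0 < w)%N -> w = (u ^ e * h w ^ n)%N -> (0 < h w)%N.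
        by case: (h w) => // w0 wE; move: w0; rewrite wE exp0n ?muln0.
      by rewrite (hpos _ _ x1 xE1) (hpos _ _ y1 yE1) (hpos _ _ z1 zE1).
    - by rewrite -!expnMn -/P; apply: arc_number_large => //; rewrite P0.
  have PR : 0 < P%:R :> R by rewrite ltr0n.
  (* Here K + 1 = 240 d + 241 with d the integer part of T / P, so P <= T even gives the bound 481
     T. *)
  have KP : K.+1%:R * P%:R <= 960 * T%:R :> R.
    rewrite -natrM -[960 * _]natrM ler_nat /K.
    have := leq_trunc_div T P; move: PT; set d := (T %/ P)%N.
    have : (P <= P * 240)%N by rewrite leq_pmulr.
    by clear; nia.
  rewrite -(ler_nat R) in sz; apply: le_trans sz _.
  pose S : R := (size (divisor_chains p))%:R * (size (divisor_chains q))%:R *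
    (size (divisor_chains r))%:R.
  have S0 : 0 <= S by rewrite !mulr_ge0.
  have -> : C * T%:R * (c p * c q * c r) = S * 256 * (960 * T%:R / P%:R).
    by rewrite /S /c /P !natrM CE; field; rewrite !pnatr_eq0 -!lt0n p0 q0 r0.
  rewrite !natrM -/S -(natrM _ p q) -(natrM _ (p * q)) -/P.
  have -> : 2 * (S * (4 * 4 * 4) * (2 * K.+1%:R)) = S * 256 * K.+1%:R by ring.
  apply: ler_wpM2l; first by rewrite mulr_ge0.
  by rewrite ler_pdivlMr.
apply: (@le_trans _ _ (\sum_(l <- ls) (size [seq t <- s | f t == l])%:R)).
  by rewrite -natr_sum ler_nat; apply: size_le_sum_fibres.
rewrite /ls big_allpairs big_allpairs.
apply: (@le_trans _ _ (\sum_(p <- I) \sum_(q <- I) \sum_(r <- I)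
    C * T%:R * (c p * c q * c r))).
  by do 3 (apply: ler_sum => ? _).
set S := \sum_(x <- I) c x.
have inner p q : \sum_(r <- I) C * T%:R * (c p * c q * c r) =
    C * T%:R * c p * S * c q.
  by rewrite -mulr_sumr -mulr_sumr -/S; ring.
have middle p : \sum_(q <- I) \sum_(r <- I) C * T%:R * (c p * c q * c r) =
    C * T%:R * S ^+ 2 * c p.
  by under eq_bigr do rewrite inner; rewrite -mulr_sumr -/S; ring.
under eq_bigr do rewrite middle.
by rewrite -mulr_sumr -/S -mulrA -exprSr.
Qed.

(** * The two cases and the final bound *)

Lemma N1_le (R : realType) (B : R) (N T : nat) :
    (forall m : nat, m%:R <= B -> (m <= N)%N) -> (0 < T)%N -> (N ^ 3 <= T ^ 5)%N ->
  (N1 B)%:R <= 2 * (256 * 960 * T%:R * harmonic_sum R N ^+ 9) :> R.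
Proof.
move=> BN T0 NT.
(* One decomposition is fixed for each squareful number, so that every triple has a single set of
   coefficients; (0, 0) is a default for all other k. *)
have /choice[dec decP] : forall k, exists ab : nat * nat,
    (0 < k)%N -> squareful k -> k = (ab.1 ^ 2 * ab.2 ^ 3)%N.
  move=> k.
  have [[k0 sq]|nsq] := pselect ((0 < k)%N /\ squareful k).
    by have [ab kE] := squareful_decomp k0 sq; exists ab.
  by exists (0, 0)%N => k0 sq; case: nsq.
pose u k := (dec k).1; pose v k := (dec k).2.
pose s : seq (nat * nat * nat) := enum_fset (fset_set (squareful_triples B)).
have sP x y z : (x, y, z) \in s ->
  [/\ [/\ (0 < x)%N, (0 < y)%N & (0 < z)%N], (x + y)%N = z, (z <= N)%N, coprime x y &
     [/\ x = (u x ^ 2 * v x ^ 3)%N, y = (u y ^ 2 * v y ^ 3)%N &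
         z = (u z ^ 2 * v z ^ 3)%N]].
  have -> : ((x, y, z) \in s) = ((x, y, z) \in squareful_triples B).
    exact: in_fset_set (finite_squareful_triples B) (x, y, z).
  rewrite inE => -[[x0 y0 z0] cop xyz [_ _ zB] [sx sy sz]].
  split=> //; [exact: BN| |by split; apply: decP].
  move: cop; rewrite -xyz /coprime => cop; apply/eqP; rewrite -[RHS]cop.
  by apply/esym/gcdn_idPl; rewrite dvdn_add ?dvdn_gcdl ?dvdn_gcdr.
pose small (t : nat * nat * nat) := (v t.1.1 * v t.1.2 * v t.2 <= T)%N.
pose s1 := [seq t <- s | small t]; pose s2 := [seq t <- s | ~~ small t].
have us : uniq s by apply: fset_uniq.
have -> : N1 B = (size s1 + size s2)%N.
  by rewrite /s1 /s2 !size_filter count_predC.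
have [C C0 CE] : exists2 C : R, 0 <= C & C = 256 * 960.
  by exists (256 * 960); [apply: mulr_ge0; exact: ler0n|reflexivity].
pose S : R := \sum_(1 <= x < N.+1) (size (divisor_chains x))%:R / x%:R.
have S0 : 0 <= S by apply: sumr_ge0 => i _; rewrite divr_ge0.
have b1 : (size s1)%:R <= C * T%:R * S ^+ 3.
  (* First the conics, with cubes as coefficients and unknowns [u]; for [s2] the roles of [u] and
     [v] are exchanged. *)
  rewrite CE; apply: (@count_small_coefs R 2 3 N T v u) => //.
    by rewrite filter_uniq.
  move=> -[[x y] z]; rewrite mem_filter => /andP[sm /sP[? ? ? ? [xE yE zE]]].
  by split=> //; split=> //; rewrite mulnC.
have b2 : (size s2)%:R <= C * T%:R * S ^+ 3.
  rewrite CE; apply: (@count_small_coefs R 3 2 N T u v) => //.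
    by rewrite filter_uniq.
  move=> -[[x y] z]; rewrite mem_filter => /andP[sm xyzs].
  have [[x0 y0 z0] xyz zN cxy [xE yE zE]] := sP _ _ _ xyzs.
  split=> //; split=> //.
  rewrite /small /= -ltnNge in sm.
  have xN : (x <= N)%N by rewrite (leq_trans _ zN) // -xyz leq_addr.
  have yN : (y <= N)%N by rewrite (leq_trans _ zN) // -xyz leq_addl.
  have prodN : (x * y * z <= N ^ 3)%N.
    by rewrite !expnS expn0 muln1 mulnA !leq_mul.
  (* When the product of the [v] exceeds T, that of the [u], squared and multiplied by T ^ 3, is at
     most x y z <= N ^ 3 <= T ^ 5; cancelling T ^ 3 bounds it by T. *)
  rewrite -(@leq_exp2r _ _ 2) // -(@leq_pmul2r (T ^ 3)) ?expn_gt0 ?T0 //.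
  rewrite -expnD; apply: leq_trans NT; apply: leq_trans prodN.
  rewrite {2}xE {2}yE {2}zE.
  apply: (@leq_trans ((u x * u y * u z) ^ 2 * (v x * v y * v z) ^ 3)).
    by rewrite leq_mul2l leq_exp2r // (ltnW sm) orbT.
  by rewrite !expnMn; apply/eq_leq; ring.
have H0 : 0 <= harmonic_sum R N by apply: sumr_ge0 => i _; rewrite invr_ge0.
have SH : S ^+ 3 <= harmonic_sum R N ^+ 9.
  rewrite (exprM _ 3 3); apply: lerXn2r; rewrite ?nnegrE ?exprn_ge0 //.
  exact: sum_divisor_chains_le.
rewrite -CE natrD.
have := ler_wpM2l (mulr_ge0 C0 (ler0n R T)) SH.
move=> XY; rewrite [leRHS]mulr_natl mulr2n.
by apply: lerD; [apply: le_trans b1 XY|apply: le_trans b2 XY].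
Qed.

Lemma ln2_ge_half (R : realType) : 2^-1 <= ln (2 : R).
Proof.
have := @le_ln1Dx R (- 2^-1).
have -> : 1 + - 2^-1 = 2^-1 :> R by field.
by rewrite lnV ?posrE // lerN2 => -> //; lra.
Qed.

Theorem theorem2 (R : realType) :
  exists2 K : R, 0 < K &
    forall B : R, 2 <= B ->
      (N1 B)%:R <= K * (B `^ (3 / 5)) * (ln B) ^+ 12.
Proof.
have [C C0 CE] : exists2 C : R, 0 < C & C = 256 * 960.
  by exists (256 * 960); [apply: mulr_gt0; rewrite ltr0n|reflexivity].
(* The 4 comes from the two cases and from T <= A + 1 <= 2 A, 3 ^ 9 from bounding the harmonic sum
   by 3 ln B, and 2 ^ 3 from passing from (ln B) ^ 9 to (ln B) ^ 12. *)
exists (4 * C * 3 ^+ 9 * 2 ^+ 3) => [|B B2].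
  by rewrite !mulr_gt0 ?exprn_gt0.
have B0 : 0 < B by lra.
set A := B `^ (3 / 5).
have A0 : 0 <= A by apply: powR_ge0.
have A1 : 1 <= A by rewrite -[leLHS](powRr0 B) ler_powR //; lra.
have A5 : A ^+ 5 = B ^+ 3.
  rewrite /A -(powR_mulrn 5 (powR_ge0 _ _)) -(powR_mulrn 3 (ltW B0)) -powRrM.
  congr (_ `^ _); by field.
pose N := Num.truncn B; pose T := (Num.truncn A).+1.
have NB : N%:R <= B by case/andP: (truncn_itv (ltW B0)).
have BN m : m%:R <= B -> (m <= N)%N by rewrite -truncn_ge_nat // ltW.
have N0 : (0 < N)%N by apply: BN; lra.
have [TA AT] : T%:R <= A + 1 /\ A < T%:R.
  have /andP[t1 t2] := truncn_itv A0; split=> //.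
  by rewrite /T -natr1 lerD2r.
have NT : (N ^ 3 <= T ^ 5)%N.
  rewrite -(ler_nat R) !natrX (@le_trans _ _ (B ^+ 3)) //.
    by rewrite lerXn2r ?nnegrE // ltW.
  by rewrite -A5 lerXn2r ?nnegrE // ltW.
apply: le_trans (N1_le BN (ltn0Sn _) NT) _; rewrite -CE.
set L := ln B.
have L2 : 2^-1 <= L.
  by apply: le_trans (ln2_ge_half R) _; rewrite ler_ln ?posrE.
(* As 1 <= 2 L, the bound 1 + L on the harmonic sum is at most 3 L. *)
have HL : harmonic_sum R N <= 3 * L.
  apply: le_trans (harmonic_sum_le R N0) _.
  have : ln N%:R <= L by rewrite ler_ln ?posrE ?ltr0n.
  by lra.
have H0 : 0 <= harmonic_sum R N by apply: sumr_ge0 => i _; rewrite invr_ge0.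
have H9 : harmonic_sum R N ^+ 9 <= 3 ^+ 9 * L ^+ 9.
  by rewrite -exprMn lerXn2r ?nnegrE // (le_trans H0).
have L0 : 0 <= L by lra.
(* The count yields only the ninth power of L; the factor (2 L) ^ 3 >= 1 raises it to the
   twelfth. *)
have L9 : L ^+ 9 <= 2 ^+ 3 * L ^+ 12.
  have -> : 2 ^+ 3 * L ^+ 12 = (2 * L) ^+ 3 * L ^+ 9 by rewrite exprMn (exprD L 3 9) mulrA.
  by rewrite ler_peMl ?exprn_ge0 // exprn_ege1 //; lra.
have -> : 4 * C * 3 ^+ 9 * 2 ^+ 3 * A * L ^+ 12 =
    2 * (C * (2 * A) * (3 ^+ 9 * (2 ^+ 3 * L ^+ 12))).
  move: (3 ^+ 9) (2 ^+ 3) (L ^+ 12) => a b c; ring.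
rewrite ler_wpM2l // ler_pM ?exprn_ge0 ?mulr_ge0 //; first exact: ltW.
  by apply: ler_wpM2l; [exact: ltW|apply: le_trans TA _; lra].
by apply: le_trans H9 _; rewrite ler_wpM2l ?exprn_ge0.
Qed.
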